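(* Let $C$ be a $d$-dimensional nested Archimedean copula of the form $$C(\boldsymbol{u})=C_0(C_1(\boldsymbol{u}_1),\dots,C_S(\boldsymbol{u}_S))=\psi_0\Bigl(\sum_{s=1}^S\psi_0^{-1}\Bigl[\psi_s\Bigl(\sum_{j=1}^{d_s}\psi_s^{-1}[u_{sj}]\Bigr)\Bigr]\Bigr),$$ where $C_0,C_1,\dots,C_S$ are Archimedean copulas of dimensions $S,d_1,\dots,d_S$ (with $\sum_{s=1}^S d_s=d$) with generators $\psi_0,\psi_1,\dots,\psi_S\in\Psi_\infty$, respectively, such that $(\psi_0^{-1}\circ\psi_s)'$ is completely monotone for all $s=1,\dots,S$. For $\boldsymbol{t}=(\boldsymbol{t}_1,\dots,\boldsymbol{t}_S)\in(0,1]^d$ such that $C(\boldsymbol{t})>0$, the copula $C_{\boldsymbol{t}}$ of $C$ right-truncated at $\boldsymbol{t}$ is given, for $\boldsymbol{u}\in[0,1]^d$, by $$C_{\boldsymbol{t}}(\boldsymbol{u})=\frac{\psi_0\Bigl(\sum_{s=1}^S\psi_0^{-1}\Bigl[\psi_s\Bigl(\sum_{j=1}^{d_s}\psi_s^{-1}\bigl[\psi_0\bigl(\psi_0^{-1}[C(\boldsymbol{t})u_{sj}]-\psi_0^{-1}[C(\boldsymbol{1};\boldsymbol{t}_{-s})]\bigr)\bigr]-(d_s-1)\psi_s^{-1}[C_s(\boldsymbol{t}_s)]\Bigr)\Bigr]\Bigr)}{C(\boldsymbol{t})},$$ where $\psi_0^{-1}[C(\boldsymbol{1};\boldsymbol{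t}_{-s})]=\psi_0^{-1}[C(\boldsymbol{t})]-\psi_0^{-1}[C_s(\boldsymbol{t}_s)]$.
   Context: For $\boldsymbol{U}\sim C$ ($C$ a $d$-dimensional copula) and $\boldsymbol{t}\in(0,1]^d$ with $C(\boldsymbol{t})>0$, the copula $C_{\boldsymbol{t}}$ of $C$ right-truncated at $\boldsymbol{t}$ is the (unique) copula of the conditional distribution of $\boldsymbol{U}$ given $\boldsymbol{U}\le\boldsymbol{t}$ (componentwise). $\Psi_\infty$ is the set of completely monotone Archimedean generators, i.e. continuous $\psi:[0,\infty)\to[0,1]$ with $\psi(0)=1$, $\lim_{t\to\infty}\psi(t)=0$ and $(-1)^k\psi^{(k)}(t)\ge0$ for all $t>0$, $k\in\mathbb{N}_0$. The Archimedean copula generated by $\psi$ is $\psi(\psi^{-1}[u_1]+\dots+\psi^{-1}[u_d])$, with conventions $\psi^{-1}[0]=\infty$, $\psi(\infty)=0$. The complete monotonicity of all $(\psi_0^{-1}\circ\psi_s)'$ (sufficient nesting condition) guarantees that $C$ is a copula. Notation: vectors are partitioned into sectors, $\boldsymbol{u}=(\boldsymbol{u}_1,\dots,\boldsymbol{u}_S)$ with $\boldsymbol{u}_s=(u_{s1},\dots,u_{sd_s})$, and likewise $\boldsymbol{t}_s=(t_{s1},\dots,t_{sd_s})$. For a $d_s$-dimensional vector $\boldsymbol{x}_s$, $C(\boldsymbol{x}_s;\boldsymbol{t}_{-s})=C(\boldsymbol{t}_1,\dots,\boldsymbol{t}_{s-1},\boldsymbol{x}_s,\boldsymbol{t}_{s+1},\dots,\boldsymbol{t}_S)$;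 $\boldsymbol{1}$ is the vector of ones. *)

(* Defs.v *)
From HB Require Import structures.
From mathcomp Require Import all_boot all_order all_algebra.
From mathcomp Require Import all_classical all_reals all_analysis.

Set Implicit Arguments.
Unset Strict Implicit.
Unset Printing Implicit Defensive.

Import Order.TTheory GRing.Theory Num.Theory.
Import numFieldNormedType.Exports.

Local Open Scope classical_set_scope.
Local Open Scope ring_scope.

(** ** Completely monotone Archimedean generators *)

Definition completely_monotone (R : realType) (f : R -> R) : Prop :=
  forall (k : nat) (t : R), 0 < t ->
    derivable (derive1n k f) t 1 /\ 0 <= (-1) ^+ k * derive1n k f t.

(* The class Psi_infty; only the values of psi on [0, +oo[ matter. *)
Record cm_generator (R : realType) (psi : R -> R) : Prop := CmGenerator {
  cmg_range : forall t, 0 <= t -> 0 <= psi t <= 1 ;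
  cmg_continuous : {within `[0, +oo[, continuous psi} ;
  cmg_at0 : psi 0 = 1 ;
  cmg_atoo : psi t @[t --> +oo] --> (0 : R) ;
  cmg_cm : completely_monotone psi
}.

(* psi on [0, +oo], with psi(+oo) = 0; the value at -oo is junk. *)
Definition gen (R : realType) (psi : R -> R) (x : \bar R) : R :=
  if x is r%:E then psi r else 0.

(* The inverse of psi as a function [0, 1] -> [0, +oo], with value +oo at 0.
   A generator of Psi_infty maps [0, +oo[ bijectively onto ]0, 1]. *)
Definition geninv (R : realType) (psi : R -> R) (u : R) : \bar R :=
  if u == 0 then +oo%E else ('pinv_(fun=> 0) `[0, +oo[ psi u)%:E.

(* (psi0^-1 \o psi1)' is completely monotone; psi0^-1 (psi1 t) is finite for
   0 < t. *)
Definition nesting_condition (R : realType) (psi0 psi1 : R -> R) : Prop :=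
  let f := fun t : R => fine (geninv psi0 (psi1 t)) in
  (forall t, 0 < t -> derivable f t 1) /\ completely_monotone (derive1 f).

Definition archimedean (R : realType) (I : finType) (psi : R -> R)
    (u : I -> R) : R :=
  gen psi (\sum_(i : I) geninv psi (u i))%E.

(** ** Vectors partitioned into sectors *)

Definition sindex (S : nat) (d : 'I_S -> nat) : finType :=
  {s : 'I_S & 'I_(d s)}.

Definition sector (T : Type) (S : nat) (d : 'I_S -> nat) (u : sindex d -> T)
    (s : 'I_S) : 'I_(d s) -> T :=
  fun j => u (existT _ s j).
Arguments sector {T S d} u s _.

(* The vector (x_s; t_{-s}): t with its sector s replaced by x. *)
Definition replace_sector (T : Type) (S : nat) (d : 'I_S -> nat)
    (t : sindex d -> T) (s : 'I_S) (x : 'I_(d s) -> T) : sindex d -> T :=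
  fun i => @dfwith _ _ (sector t) s x (tag i) (tagged i).
Arguments replace_sector {T S d} t s x _.

(** ** Copulas *)

Definition in_cube (R : realType) (I : finType) (u : I -> R) : Prop :=
  forall i, 0 <= u i <= 1.

Section random_vectors.
Context (R : realType) (I : finType) (dT : measure_display)
        (T : measurableType dT).

Definition le_event (X : I -> {mfun T >-> R}) (x : I -> R) : set T :=
  [set w | forall i, X i w <= x i].

Lemma measurable_le_event (X : I -> {mfun T >-> R}) (x : I -> R) :
  measurable (le_event X x).
Proof.
rewrite (_ : le_event X x =
    \bigcap_(i in [set: I]) (X i @^-1` `]-oo, x i])); last first.
  apply/seteqP; split=> w /=.
    by move=> h i _ /=; rewrite in_itv /=.
  by move=> h i; have := h i Logic.I; rewrite /= in_itv.
apply: fin_bigcap_measurable => // i _.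
by rewrite -[X in measurable X]setTI; exact: measurable_funP.
Qed.

(* U ~ C: C is, on the unit cube, the distribution function of U, and the
   margins of U are standard uniform. The values of C off the cube are junk. *)
Definition follows (P : probability T R) (U : I -> {RV P >-> R})
    (C : (I -> R) -> R) : Prop :=
  (forall i (x : R), 0 <= x <= 1 -> cdf (U i) x = x%:E) /\
  (forall u, in_cube u -> P (le_event U u) = (C u)%:E).

(* The conditional probability P(. | A), that is B |-> P(B `&` A) / P(A);
   junk if P(A) = 0. *)
Definition conditional (P : probability T R) (A : set T)
    (mA : measurable A) : probability T R :=
  mnormalize (mrestr P mA) P.

End random_vectors.

Definition is_copula (R : realType) (I : finType) (C : (I -> R) -> R) : Prop :=
  exists (dT : measure_display) (T : measurableType dT)
         (P : probability T R) (U : I -> {RV P >-> R}), follows U C.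

(* D is a copula of the random vector X: Sklar's identity. *)
Definition is_copula_of (R : realType) (I : finType) (dT : measure_display)
    (T : measurableType dT) (P : probability T R) (X : I -> {RV P >-> R})
    (D : (I -> R) -> R) : Prop :=
  is_copula D /\
  forall x : I -> R,
    P (le_event X x) = (D (fun i => fine (cdf (X i) (x i))))%:E.

(* D is the copula of the distribution of U given U <= t; copulas are
   identified when they agree on the unit cube. *)
Definition is_truncated_copula (R : realType) (I : finType)
    (dT : measure_display) (T : measurableType dT) (P : probability T R)
    (U : I -> {RV P >-> R}) (t : I -> R) (D : (I -> R) -> R) : Prop :=
  let Q := conditional P (measurable_le_event U t) in
  @is_copula_of R I dT T Q U D /\
  forall D', @is_copula_of R I dT T Q U D' ->
    forall u, in_cube u -> D' u = D u.

(* Main.v *)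
Require Import Defs.
From HB Require Import structures.
From mathcomp Require Import all_boot all_order all_algebra.
From mathcomp Require Import all_classical all_reals all_analysis.
From mathcomp Require Import lra.

Set Implicit Arguments.
Unset Strict Implicit.
Unset Printing Implicit Defensive.

Import Order.TTheory GRing.Theory Num.Theory.
Import numFieldNormedType.Exports.

Local Open Scope classical_set_scope.
Local Open Scope ring_scope.

(** The proof rests on three independent facts.

    A completely monotone generator psi with limit 0 is positive and strictly
    decreasing, so that gen psi and geninv psi are inverse bijections between
    [0, +oo] and [0, 1] (genK, geninvK).  Only then do expressions such as
    geninv psi0 (archimedean psi u) simplify to sums.  Positivity is where
    complete monotonicity matters: a merely convex generator may vanish from
    some point on.  The differences x |-> psi x - psi (x + h) of a completely
    monotone function are again completely monotone; iterating them n times at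
    a point x such that psi vanishes beyond x + 2h gives
    psi x - n psi (x + h) >= 0 for all n, hence psi (x + h) = 0
    (cm_eq0_propagates).  Zeros therefore propagate towards the origin, which
    contradicts psi 0 = 1.

    Given U <= t, the distribution function at x is C(y) / C(t), where y is x
    clamped coordinatewise to [0, t], and the i-th margin at x_i is C(t with
    y_i at place i) / C(t).  Conditioning on an event of positive probability
    keeps the margins continuous, and the conditional law lives on a box, so
    every margin takes all values in [0, 1].  For margins with this property,
    any function that satisfies Sklar's identity is a copula, namely the
    distribution function of the integral transforms of the coordinates, and it
    is determined on the whole cube (sklar).  So the theorem reduces to the
    functional equation of truncated_copulaP.

    For a nested Archimedean C, geninv psi0 (C u) is the sum over the sectors of
    geninv psi0 (C_s(u_s)).  When t is changed inside sector s only, subtracting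
    the contribution geninv psi0 (C(1; t_{-s})) of the other sectors isolates
    C_s of the modified sector.  Applying geninv (psi s) and summing over the
    entries j of the sector yields the wanted sum of geninv (psi s) (y_sj), plus
    d_s - 1 copies of geninv (psi s) (C_s(t_s)), which the formula removes
    (nested_sector_inversion). *)

(** * Completely monotone functions *)

Section completely_monotone_functions.
Context (R : realType).
Implicit Types (f psi : R -> R) (h t x y : R).

Lemma cm_derivative_nonincreasing f k x y : completely_monotone f ->
  0 < x -> x <= y ->
  (-1) ^+ k * derive1n k f y <= (-1) ^+ k * derive1n k f x.
Proof.
move=> fcm x0 xy; set g := fun z => (-1) ^+ k * derive1n k f z.
have gd (z : R) : 0 < z -> is_derive z 1 g ((-1) ^+ k * derive1n k.+1 f z).
  move=> z0; have [dz _] := fcm k z z0.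
  have := @is_deriveZ _ _ _ (derive1n k f) ((-1) ^+ k) z 1 _ (DeriveDef dz erefl).
  by rewrite derive1nS derive1E.
have gx (z : R) : z \in `]x, +oo[ -> 0 < z.
  by rewrite in_itv /= andbT; exact: lt_trans.
apply: (@ler0_derive1_nincry _ g x) => //.
- by move=> z /gx/gd[].
- move=> z /gx z0; have [_ +] := fcm k.+1 z z0.
  rewrite exprS mulN1r mulNr oppr_ge0 derive1E.
  by have [_ ->] := gd z z0.
- apply: derivable_within_continuous => z; rewrite in_itv /= andbT => xz.
  by have [] := gd z (lt_le_trans x0 xz).
Qed.

Lemma cm_nonincreasing f x y : completely_monotone f ->
  0 < x -> x <= y -> f y <= f x.
Proof.
move=> fcm x0 xy; have := cm_derivative_nonincreasing 0 fcm x0 xy.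
by rewrite expr0 !mul1r.
Qed.

(** Since every (-1)^k f^(k) is nonincreasing, the class is closed under
    forward differences. *)
Lemma cm_sub_shift f h : 0 <= h -> completely_monotone f ->
  completely_monotone (fun x => f x - f (x + h)).
Proof.
move=> h0 fcm; set g := fun x => _.
have gd k (t : R) : 0 < t ->
    is_derive t 1 (fun x => derive1n k f x - derive1n k f (x + h))
      (derive1n k.+1 f t - derive1n k.+1 f (t + h)).
  move=> t0; have th0 : 0 < t + h by rewrite ltr_pwDl.
  have [d1 _] := fcm k t t0; have [d2 _] := fcm k _ th0.
  rewrite !derive1nS !derive1E; apply: is_deriveB.
    exact: DeriveDef.
  have -> : 'D_1 (derive1n k f) (t + h) = 'D_1 (derive1n k f) (t + h) * 1.
    by rewrite mulr1.
  apply: (@is_derive1_comp _ (derive1n k f) (fun x => x + h)).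
    exact: DeriveDef.
  rewrite -[X in is_derive _ _ _ X]addr0; apply: is_deriveD.
have gE k (t : R) : 0 < t ->
    derive1n k g t = derive1n k f t - derive1n k f (t + h).
  elim: k t => [//|k IH] t t0.
  have [_ <-] := gd k t t0.
  rewrite derive1nS derive1E; apply: near_eq_derive.
  by near=> x; apply: IH; near: x; exact: lt_nbhsr.
move=> k t t0; split.
  have [+ _] := gd k t t0; apply: near_eq_derivable.
  by near=> x; rewrite gE//; near: x; exact: lt_nbhsr.
rewrite gE// mulrBr subr_ge0.
by apply: cm_derivative_nonincreasing; rewrite // lerDl.
Unshelve. all: by end_near.
Qed.

Lemma cm_ge0 f x : completely_monotone f -> 0 < x -> 0 <= f x.
Proof. by move=> fcm x0; have [_] := fcm 0 x x0; rewrite expr0 mul1r. Qed.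

(** As f vanishes from x + 2h on, (-1)^n times its n-th forward difference of
    step h at x reduces to f x - n f(x + h).  It is nonnegative for every n. *)
Lemma cm_eq0_propagates f x h : completely_monotone f -> 0 < x -> 0 <= h ->
  f (x + h *+ 2) = 0 -> f (x + h) = 0.
Proof.
move=> fcm x0 h0 fz.
have f0 y : x + h *+ 2 <= y -> f y = 0.
  have xh0 : 0 < x + h *+ 2 by rewrite ltr_pwDl// mulrn_wge0.
  move=> xy; apply/eqP; rewrite eq_le -{1}fz cm_nonincreasing//=.
  by rewrite cm_ge0// (lt_le_trans xh0).
(* g is (-1)^n times the n-th forward difference of f, of step h. *)
have gn n : exists g, [/\ completely_monotone g, g x = f x - f (x + h) *+ n &
    forall y, x + h <= y -> g y = f y].
  elim: n => [|n [g [gcm gx gf]]].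
    by exists f; split; rewrite // mulr0n subr0.
  exists (fun y => g y - g (y + h)); split; first exact: cm_sub_shift.
    by rewrite gx gf// mulrSr opprD addrA.
  move=> y xy; rewrite [g (y + h)]gf; last by rewrite (le_trans xy)// lerDl.
  by rewrite f0 ?subr0 ?gf//; rewrite mulr2n addrA lerD2r.
have le_n n : f (x + h) *+ n <= f x.
  by have [g [gcm gx _]] := gn n; rewrite -subr_ge0 -gx cm_ge0.
have fxh0 : 0 <= f (x + h) by rewrite cm_ge0// ltr_pwDl.
apply/eqP; rewrite eq_le fxh0 andbT leNgt; apply/negP => fpos.
have /archi_boundP : 0 <= f x / f (x + h) by rewrite divr_ge0// cm_ge0.
by rewrite ltr_pdivrMr// mulr_natl ltNge le_n.
Qed.

End completely_monotone_functions.

(** * Generators as bijections from [0, +oo] to [0, 1] *)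

Section generators.
Context (R : realType) (psi : R -> R) (psiP : cm_generator psi).
Implicit Types (x y u v : R).

Lemma cm_generator_nonincreasing x y : 0 <= x -> x <= y -> psi y <= psi x.
Proof.
have pcm := cmg_cm psiP.
rewrite le_eqVlt => /predU1P[<-|x0]; last exact: cm_nonincreasing.
move=> y0; rewrite (cmg_at0 psiP).
by have /andP[] := cmg_range psiP y0.
Qed.

(** From a zero at y, taking the step y / 4 at the point y / 2 gives a zero at
    3 y / 4; repeating this contradicts psi 0 = 1 and continuity at 0. *)
Lemma cm_generator_gt0 x : 0 <= x -> 0 < psi x.
Proof.
have pcm := cmg_cm psiP.
have p0 := cmg_at0 psiP.
rewrite le_eqVlt => /predU1P[<-|x0]; first by rewrite p0.
rewrite lt_def (cm_ge0 pcm x0) andbT; apply/eqP => px0.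
have q0 : 0 < 3 / 4 :> R by lra.
have zn n : psi ((3 / 4) ^+ n * x) = 0.
  elim: n => [|n IH]; first by rewrite expr0 mul1r.
  set y := _ * x in IH.
  have y0 : 0 < y by rewrite mulr_gt0// exprn_gt0.
  have /(_ (y / 4)) := @cm_eq0_propagates _ psi (y / 2) _ pcm _.
  have -> : y / 2 + y / 4 *+ 2 = y by lra.
  have -> : y / 2 + y / 4 = (3 / 4) ^+ n.+1 * x by rewrite exprS -mulrA -/y; lra.
  by apply; rewrite ?divr_ge0 ?divr_gt0 ?ltW.
have cv : (3 / 4) ^+ n * x @[n --> \oo] --> (0 : R).
  rewrite -[X in _ --> X](mul0r x); apply: cvgMl.
  by apply: cvg_expr; rewrite ger0_norm; lra.
have /continuous_within_itvcyP[_ p0r] := cmg_continuous psiP.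
have /cvg_lim : psi ((3 / 4) ^+ n * x) @[n --> \oo] --> psi 0.
  apply: ((cvg_at_rightP psi 0 (psi 0)).1 p0r (fun n => (3 / 4) ^+ n * x)).
  by split=> // n; rewrite mulr_gt0// exprn_gt0.
under eq_fun do rewrite zn.
rewrite p0 lim_cst// => /(_ (@norm_hausdorff _ _))/eqP.
by rewrite eq_sym oner_eq0.
Qed.

(** If psi took the same value at x and x + h, the difference of step h,
    which is completely monotone, would vanish from x on; psi would then be
    h-periodic there and could not tend to 0 from a positive value. *)
Lemma cm_generator_lt x y : 0 <= x -> x < y -> psi y < psi x.
Proof.
have pcm := cmg_cm psiP => x0 xy.
(* Complete monotonicity says nothing at 0: when x = 0, compare psi y with
   the value of psi at the midpoint of x and y. *)
wlog x_gt0 : x x0 xy / 0 < x.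
  move=> wlg; have xz : x < (x + y) / 2 by lra.
  apply: (@lt_le_trans _ _ (psi ((x + y) / 2))).
    by apply: wlg; lra.
  by apply: cm_generator_nonincreasing; lra.
rewrite lt_neqAle cm_generator_nonincreasing ?ltW// andbT; apply/eqP => exy.
set h := y - x; have h0 : 0 < h by rewrite subr_gt0.
have gcm : completely_monotone (fun z => psi z - psi (z + h)).
  by apply: cm_sub_shift => //; exact: ltW.
have ph z : x <= z -> psi (z + h) = psi z.
  move=> xz; apply/esym/eqP; rewrite -subr_eq0 eq_le.
  rewrite (cm_ge0 gcm) ?(lt_le_trans x_gt0)// andbT.
  by rewrite (le_trans (cm_nonincreasing gcm x_gt0 xz))// subrKC exy subrr.
have pn n : psi (x + h *+ n) = psi x.
  elim: n => [|n IH]; first by rewrite mulr0n addr0.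
  by rewrite mulrSr addrA ph// lerDl mulrn_wge0// ltW.
have /cvg_lim : psi (x + h *+ n) @[n --> \oo] --> (0 : R).
  apply: cvg_comp (cmg_atoo psiP).
  apply/cvgryPge => A; near=> n.
  rewrite -lerBlDl -mulr_natl -ler_pdivrMr//.
  by near: n; exact: nbhs_infty_ger.
under eq_fun do rewrite pn.
rewrite lim_cst// => /(_ (@norm_hausdorff _ _)) px0.
by have := cm_generator_gt0 (ltW x_gt0); rewrite px0 ltxx.
Unshelve. all: by end_near.
Qed.

Lemma cm_generator_inj : {in `[0, +oo[%classic &, injective psi}.
Proof.
move=> x y; rewrite !inE /= !in_itv /= !andbT => x0 y0 exy.
by case: (ltgtP x y) => // [/(cm_generator_lt x0)|/(cm_generator_lt y0)];
  rewrite exy ltxx.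
Qed.

Lemma cm_generator_surj u : 0 < u <= 1 -> exists2 x, 0 <= x & psi x = u.
Proof.
move=> /andP[u0 u1].
have [M [M0 psiM]] : exists M, 0 <= M /\ psi M <= u.
  near (pinfty_nbhs R) => M; exists M; split; first by near: M; exact: nbhs_pinfty_ge.
  by near: M; apply: (cvgr_le 0) => //; exact: (cmg_atoo psiP).
have pc : {within `[0, M], continuous psi}.
  apply: continuous_subspaceW (cmg_continuous psiP) => z /=.
  by rewrite !in_itv /= => /andP[-> _].
have [|c] := @IVT _ psi 0 M u M0 pc.
  by rewrite (cmg_at0 psiP) ge_min le_max psiM u1 orbT.
by rewrite in_itv /= => /andP[c0 _] <-; exists c.
Unshelve. all: by end_near.
Qed.

Lemma gen_itv01 (x : \bar R) : (0 <= x)%E -> 0 <= gen psi x <= 1.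
Proof.
case: x => [r| |]//=; last by rewrite lexx ler01.
by rewrite lee_fin; exact: (cmg_range psiP).
Qed.

Lemma genK (x : \bar R) : (0 <= x)%E -> geninv psi (gen psi x) = x.
Proof.
case: x => [r| |]//=; last by rewrite /geninv eqxx.
rewrite lee_fin => r0; rewrite /geninv gt_eqF ?cm_generator_gt0//.
rewrite pinvKV//; first exact: cm_generator_inj.
by rewrite inE /= in_itv /= r0.
Qed.

Lemma gen_surj u : 0 <= u <= 1 ->
  exists2 x : \bar R, (0 <= x)%E & gen psi x = u.
Proof.
move=> /andP[]; rewrite le_eqVlt => /predU1P[<- _|u0 u1].
  by exists +oo%E.
have [|x x0 <-] := @cm_generator_surj u; first by rewrite u0.
by exists x%:E.
Qed.

Lemma geninvK u : 0 <= u <= 1 -> gen psi (geninv psi u) = u.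
Proof. by move=> /gen_surj[x x0 <-]; rewrite genK. Qed.

Lemma geninv_ge0 u : 0 <= u <= 1 -> (0 <= geninv psi u)%E.
Proof. by move=> /gen_surj[x x0 <-]; rewrite genK. Qed.

Lemma geninv1 : geninv psi 1 = 0%E.
Proof. by rewrite -(cmg_at0 psiP) -[psi 0]/(gen psi 0%E) genK. Qed.

Lemma archimedean_itv01 (I : finType) (u : I -> R) : in_cube u ->
  0 <= archimedean psi u <= 1.
Proof. by move=> u01; apply/gen_itv01/sume_ge0 => i _; exact: geninv_ge0. Qed.

Lemma geninv_archimedean (I : finType) (u : I -> R) : in_cube u ->
  geninv psi (archimedean psi u) = (\sum_i geninv psi (u i))%E.
Proof. by move=> u01; rewrite genK// sume_ge0// => i _; exact: geninv_ge0. Qed.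

End generators.

(** * Random vectors whose margins take all values in [0, 1] *)

Section sklar_identity.
Context (R : realType) (dT : measure_display) (T : measurableType dT)
        (P : probability T R).

Lemma measurable_fin_forall (I : finType) (A : I -> set T) :
  (forall i, measurable (A i)) -> measurable [set w | forall i, A i w].
Proof.
move=> mA; rewrite (_ : [set _ | _] = \bigcap_(i in [set: I]) A i).
  by apply: fin_bigcap_measurable => // i _; exact: mA.
by apply/seteqP; split=> w /= Aw i; [move=> _|]; exact: Aw.
Qed.

(** Each B i `\` A i is null, hence so is their finite union. *)
Lemma eq_probability_fin_forall (I : finType) (A B : I -> set T) :
  (forall i, measurable (A i)) -> (forall i, measurable (B i)) ->
  (forall i, A i `<=` B i) -> (forall i, P (A i) = P (B i)) ->
  P [set w | forall i, A i w] = P [set w | forall i, B i w].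
Proof.
move=> mA mB AB PAB.
have BA : {ae P, forall w, forall i, B i w -> A i w}.
  apply: filter_forall => i.
  exists (B i `\` A i); split=> [| |w /= /not_implyP//].
    exact: measurableD.
  have -> : P (B i `\` A i) = (P (B i) - P (A i))%E.
    rewrite measureD// ?(setIidr (AB i))// ltey_eq.
    by rewrite fin_num_measure.
  by rewrite PAB subee// fin_num_measure.
have [N [mN PN0 BAN]] := BA.
have [mAs mBs] := (measurable_fin_forall mA, measurable_fin_forall mB).
apply/eqP; rewrite eq_le; apply/andP; split.
  by apply: le_measure; rewrite ?inE// => w Aw i; exact: AB.
rewrite -[leRHS]addr0 -[X in (_ + X)%E]PN0.
apply: le_trans (measureU2 _ mAs mN).
apply: le_measure; rewrite ?inE//; first exact: measurableU.
move=> w Bw; have [Nw|nNw] := pselect (N w); [by right|left].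
move=> i; have := Bw i; move: i; apply: contrapT => nA; exact: nNw (BAN _ nA).
Qed.

Definition rcdf (X : {RV P >-> R}) (x : R) : R := fine (cdf X x).

Lemma cdfE (X : {RV P >-> R}) x : cdf X x = P [set w | X w <= x].
Proof. by congr (P _); apply/seteqP; split=> w /=; rewrite in_itv. Qed.

Lemma measurable_le_cst (X : {RV P >-> R}) x :
  measurable [set w | X w <= x].
Proof.
have := measurable_funPTI X (measurable_itv `]-oo, x]).
by congr measurable; apply/seteqP; split=> w /=; rewrite in_itv.
Qed.

Lemma rcdfE (X : {RV P >-> R}) x : (rcdf X x)%:E = cdf X x.
Proof. by rewrite fineK// fin_num_measure. Qed.

Lemma rcdf_itv01 (X : {RV P >-> R}) x : 0 <= rcdf X x <= 1.
Proof. by rewrite -!lee_fin rcdfE cdf_ge0 cdf_le1. Qed.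

Lemma rcdf_nondecreasing (X : {RV P >-> R}) : nondecreasing (rcdf X).
Proof. by move=> x y xy; rewrite -lee_fin !rcdfE cdf_nondecreasing. Qed.

Definition integral_transform (X : {RV P >-> R}) (w : T) : R := rcdf X (X w).

Lemma measurable_integral_transform (X : {RV P >-> R}) :
  measurable_fun setT (integral_transform X).
Proof.
apply: (@measurableT_comp _ _ _ _ _ _ (rcdf X)) => //.
by apply: measurable_realfun.nondecreasing_measurable => //; exact: rcdf_nondecreasing.
Qed.

HB.instance Definition _ (X : {RV P >-> R}) :=
  isMeasurableFun.Build _ _ _ _ (integral_transform X)
    (measurable_integral_transform X).

(** The event on the left may be strictly larger than {X <= x}, as rcdf X may be
    flat to the right of x.  However it is contained in {X <= y} for every y
    with rcdf X y > rcdf X x, and such values of rcdf X come arbitrarily close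
    to rcdf X x, unless the latter is 1. *)
Lemma probability_integral_transform (X : {RV P >-> R}) x :
  (forall u, 0 <= u <= 1 -> exists y, rcdf X y = u) ->
  P [set w | integral_transform X w <= rcdf X x] = cdf X x.
Proof.
move=> Xsurj.
have mle z : measurable [set w | integral_transform X w <= z].
  exact: (measurable_le_cst (integral_transform X : {RV P >-> R})).
apply/eqP; rewrite eq_le; apply/andP; split; last first.
  rewrite cdfE; apply: le_measure; rewrite ?inE//; first exact: measurable_le_cst.
  by move=> w /= Xw; exact: rcdf_nondecreasing.
apply/lee_addgt0Pr => e e0; rewrite -rcdfE -EFinD.
have [e1|e1] := leP (rcdf X x + e) 1; last first.
  by rewrite (le_trans (probability_le1 P (mle _)))// lee_fin ltW.
have [|y ye] := Xsurj (rcdf X x + e).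
  have /andP[F0 _] := rcdf_itv01 X x; rewrite e1 andbT addr_ge0//; exact: ltW.
rewrite -ye rcdfE cdfE; apply: le_measure; rewrite ?inE//.
  exact: measurable_le_cst.
move=> w /= Xw; rewrite leNgt; apply/negP => /ltW/(rcdf_nondecreasing X).
rewrite ye => /le_trans/(_ Xw); rewrite /integral_transform.
lra.
Qed.

(** Every point of the cube is the image under the margins of some x, which
    gives uniqueness.  For existence, {V_i <= rcdf (X i) (x i)} and
    {X i <= x i} have the same probability and one contains the other, where
    V_i is the transform of X i; so the joint events agree too, and D is the
    distribution function of V. *)
Lemma sklar (I : finType) (X : I -> {RV P >-> R}) (D : (I -> R) -> R) :
  (forall i u, 0 <= u <= 1 -> exists x, rcdf (X i) x = u) ->
  (forall x, P (le_event X x) = (D (fun i => rcdf (X i) (x i)))%:E) ->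
  is_copula_of X D /\
  forall D', is_copula_of X D' -> forall u, in_cube u -> D' u = D u.
Proof.
move=> Xsurj XD.
have cube u : in_cube u -> exists x, (fun i => rcdf (X i) (x i)) = u.
  move=> u01; have /choice[x xu] i := Xsurj i (u i) (u01 i).
  by exists x; apply/funext.
split; last first.
  move=> D' [_ XD'] u /cube[x <-]; apply: EFin_inj.
  by rewrite -XD -XD'.
split=> //; exists dT, T, P, (fun i => integral_transform (X i)); split.
  move=> i x x01; have [y yx] := Xsurj i x x01.
  by rewrite cdfE -[in RHS]yx rcdfE -(probability_integral_transform y (Xsurj i)) yx.
move=> _ /cube[x <-]; rewrite -XD; apply/esym/eq_probability_fin_forall => i.
- exact: measurable_le_cst.
- exact: (measurable_le_cst (integral_transform (X i) : {RV P >-> R})).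
- by move=> w /=; exact: rcdf_nondecreasing.
- by rewrite -cdfE probability_integral_transform//; exact: Xsurj.
Qed.

End sklar_identity.

(** * Right truncation of a vector with uniform margins *)

Section conditioning.
Context (R : realType) (dT : measure_display) (T : measurableType dT)
        (P : probability T R).

Lemma conditionalE (A B : set T) (mA : measurable A) : P A != 0%E ->
  conditional P mA B = (P (B `&` A) * ((fine (P A))^-1)%:E)%E.
Proof.
move=> PA0; rewrite /conditional /= /mnormalize /= /mrestr setTI (negbTE PA0) /=.
by rewrite -leye_eq leNgt ltey_eq fin_num_measure.
Qed.

(** The increments of the conditional distribution function are at most those
    of the unconditional one divided by P A. *)
Lemma conditional_cdf_continuous (A : set T) (mA : measurable A)
    (X : {RV P >-> R}) : P A != 0%E -> continuous (rcdf X) ->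
  continuous (rcdf (X : {RV conditional P mA >-> R})).
Proof.
move=> PA0 Xc; set F := rcdf (X : {RV conditional P mA >-> R}).
set p := fine (P A).
have p0 : 0 < p by rewrite fine_gt0// lt0e PA0 measure_ge0 ltey_eq fin_num_measure.
have FE x : F x = fine (P ([set w | X w <= x] `&` A)) / p.
  apply: EFin_inj; rewrite rcdfE cdfE conditionalE// EFinM fineK//.
  rewrite fin_num_measure//; apply: measurableI => //.
  exact: measurable_le_cst.
have Flip x y : x <= y -> F y - F x <= (rcdf X y - rcdf X x) / p.
  move=> xy.
  have mx := measurable_le_cst X x; have my := measurable_le_cst X y.
  rewrite !FE -mulrBl ler_pM2r ?invr_gt0// lerBlDr -lee_fin !EFinD EFinN.
  rewrite !rcdfE !cdfE.
  have -> : (P [set w | (X w <= y)%R] - P [set w | (X w <= x)%R] =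
      P ([set w | (X w <= y)%R] `\` [set w | (X w <= x)%R]))%E.
    rewrite measureD ?ltey_eq ?fin_num_measure//.
    congr (_ - P _)%E; apply/esym/setIidr => w /= /le_trans; exact.
  have mI z : measurable ([set w | X w <= z] `&` A).
    by apply: measurableI => //; exact: measurable_le_cst.
  rewrite !fineK ?fin_num_measure//.
  have mD := measurableD my mx.
  apply: le_trans (measureU2 _ mD (mI x)).
  apply: le_measure; rewrite ?inE//; first exact: measurableU.
  move=> w [/= wy Aw]; have [wx|wx] := pselect (X w <= x); [by right|by left].
move=> a; apply/cvgrPdist_le => e e0.
have /cvgrPdist_le/(_ (e * p)) := Xc a.
rewrite mulr_gt0// => /(_ isT); apply: filterS => z.
rewrite -ler_pdivrMr// => az_e; apply: le_trans az_e.
have [az|za] := leP a z.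
  rewrite (distrC (F a)) (distrC (rcdf X a)) !ger0_norm ?subr_ge0; first exact: Flip.
  - exact: rcdf_nondecreasing.
  - exact: rcdf_nondecreasing.
rewrite !ger0_norm ?subr_ge0; first exact/Flip/ltW.
- exact/rcdf_nondecreasing/ltW.
- exact/rcdf_nondecreasing/ltW.
Qed.

End conditioning.

Section truncation.
Context (R : realType) (dT : measure_display) (T : measurableType dT)
        (P : probability T R).

Lemma uniform_rcdf (X : {RV P >-> R}) :
  (forall x, 0 <= x <= 1 -> cdf X x = x%:E) ->
  forall x, rcdf X x = Num.min (Num.max 0 x) 1.
Proof.
move=> Xu x; have Xru z : 0 <= z <= 1 -> rcdf X z = z.
  by move=> z01; rewrite /rcdf Xu.
have /andP[F0 F1] := rcdf_itv01 X x.
have := Xru 0; rewrite lexx ler01 => /(_ isT) X0.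
have := Xru 1; rewrite lexx ler01 => /(_ isT) X1.
have [x0|x0] := leP 0 x; last first.
  rewrite min_l//; apply/eqP; rewrite eq_le F0 andbT -X0.
  exact/rcdf_nondecreasing/ltW.
have [x1|x1] := leP x 1; first by rewrite Xru// x0.
apply/eqP; rewrite eq_le F1 -X1 /=.
exact/rcdf_nondecreasing/ltW.
Qed.

Lemma uniform_rcdf_continuous (X : {RV P >-> R}) :
  (forall x, 0 <= x <= 1 -> cdf X x = x%:E) -> continuous (rcdf X).
Proof.
move=> Xu; have -> : rcdf X = ((fun=> 0) \max id) \min (fun=> 1).
  exact/funext/uniform_rcdf.
move=> x; apply: (@continuous_min R R); last exact: cvg_cst.
by apply: (@continuous_max R R); [exact: cvg_cst|exact: cvg_id].
Qed.

Context (I : finType) (U : I -> {RV P >-> R}) (C : (I -> R) -> R) (t : I -> R)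
  (UC : follows U C) (t01 : forall i, 0 < t i <= 1) (Ct_gt0 : 0 < C t).

Let A := le_event U t.
Let Q := conditional P (measurable_le_event U t).
Let X (i : I) : {RV Q >-> R} := U i.

Definition clamp (a x : R) : R := Num.min (Num.max 0 x) a.

Lemma clamp_itv a x : 0 <= a -> 0 <= clamp a x <= a.
Proof. by move=> a0; rewrite /clamp le_min a0 le_max lexx ge_min lexx orbT. Qed.

Let clamp_itv01 i x : 0 <= clamp (t i) x <= 1.
Proof.
have /andP[t0 t1] := t01 i.
by have /andP[-> /le_trans ->] := clamp_itv x (ltW t0).
Qed.

Let t_cube : in_cube t.
Proof. by move=> i; have /andP[t0 ->] := t01 i; rewrite ltW. Qed.

Let PA : P A = (C t)%:E.
Proof. by have [_ ->] := UC. Qed.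

Let PA0 : P A != 0%E.
Proof. by rewrite PA eqe gt_eqF. Qed.

(** Clamping below at 0 as well as above at t keeps the argument of C in the
    cube; it changes the events only by null sets, as U >= 0 almost surely. *)
Lemma truncated_df x :
  Q (le_event U x) = (C (fun i => clamp (t i) (x i)) / C t)%:E.
Proof.
rewrite /Q conditionalE// -/A PA /= EFinM; congr (_ * _)%E.
have [Uu UE] := UC; rewrite -UE; last by move=> i; exact: clamp_itv01.
transitivity (P [set w | forall i, U i w <= Num.min (x i) (t i)]).
  congr (P _); apply/seteqP; split=> w /=.
    by move=> [wx wt] i; rewrite le_min wx wt.
  by move=> wxt; split=> i; have := wxt i; rewrite le_min => /andP[].
apply: eq_probability_fin_forall => i.
- exact: measurable_le_cst.
- exact: measurable_le_cst.
- move=> w /= /le_trans; apply.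
  by rewrite /clamp le_min ge_min le_max lexx orbT ge_min lexx orbT.
- rewrite -!cdfE -!rcdfE !(uniform_rcdf (Uu i)) /clamp; congr _%:E.
  have /andP[/ltW t0 _] := t01 i.
  have [//|x0] := ltP 0 (x i).
  by rewrite (min_l (le_trans x0 t0)) (min_l t0) max_l// maxxx.
Qed.

Lemma truncated_margin i x :
  rcdf (X i) x = C (fun k => if k == i then clamp (t i) x else t k) / C t.
Proof.
apply: EFin_inj; rewrite rcdfE cdfE /Q.
pose y k := if k == i then x else t k.
have -> : C (fun k => if k == i then clamp (t i) x else t k) =
          C (fun k => clamp (t k) (y k)).
  congr C; apply/funext => k; rewrite /y; case: eqVneq => [->//|_].
  by have /andP[t0 _] := t01 k; rewrite /clamp max_r ?ltW// minxx.
rewrite -truncated_df /Q !conditionalE//; congr (P _ * _)%E.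
apply/seteqP; split=> w /= [wx wt]; split=> //.
  by move=> k; rewrite /y; case: eqVneq => [->|_].
by have := wx i; rewrite /y eqxx.
Qed.

(** The margin is continuous, is 0 at 0 and 1 at t i. *)
Lemma truncated_margin_surj i u : 0 <= u <= 1 -> exists x, rcdf (X i) x = u.
Proof.
move=> u01; have /andP[t0 t1] := t01 i.
have Fc : continuous (rcdf (X i)).
  apply: conditional_cdf_continuous => //.
  apply: uniform_rcdf_continuous; have [Uu _] := UC; exact: Uu.
have F0 : rcdf (X i) 0 = 0.
  apply/eqP; rewrite eq_le; have /andP[-> _] := rcdf_itv01 (X i) 0.
  rewrite andbT -lee_fin rcdfE cdfE conditionalE//.
  have -> : P ([set w | X i w <= 0] `&` le_event U t) = 0%E; last by rewrite mul0e.
  apply: (subset_measure0 _ (measurable_le_cst (U i) 0)) => //.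
  - apply: measurableI; first exact: measurable_le_cst.
    exact: measurable_le_event.
  - by have [/(_ i 0)] := UC; rewrite cdfE lexx ler01 => /(_ isT).
have Ft : rcdf (X i) (t i) = 1.
  rewrite truncated_margin.
  rewrite [X in C X](_ : _ = t) ?divff ?gt_eqF//; apply/funext => k.
  by case: eqVneq => // ->; rewrite /clamp max_r ?minxx// ltW.
have [||x _ <-] := @IVT _ (rcdf (X i)) 0 (t i) u (ltW t0); last by exists x.
  exact: continuous_subspaceT.
by rewrite F0 Ft min_l ?max_r.
Qed.

(** The hypothesis is Sklar's identity for the law of U given U <= t, written
    in terms of C. *)
Lemma truncated_copulaP (D : (I -> R) -> R) :
  (forall y, (forall i, 0 <= y i <= t i) ->
    D (fun i => C (fun k => if k == i then y i else t k) / C t) = C y / C t) ->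
  is_truncated_copula U t D.
Proof.
move=> DC; apply: sklar; first exact: truncated_margin_surj.
move=> x; rewrite truncated_df -DC.
  by congr (D _)%:E; apply/funext => i; rewrite -truncated_margin.
by move=> i; apply: clamp_itv; have /andP[/ltW] := t01 i.
Qed.

End truncation.

(** * Nested Archimedean copulas *)

Lemma geninv_fin_num (R : realType) (psi : R -> R) (u : R) :
  0 < u -> geninv psi u \is a fin_num.
Proof. by move=> u0; rewrite /geninv gt_eqF. Qed.

Section archimedean_copulas.
Context (R : realType) (psi : R -> R) (psiP : cm_generator psi) (I : finType).

Lemma archimedean_gt0 (u : I -> R) : (forall i, 0 < u i <= 1) ->
  0 < archimedean psi u.
Proof.
move=> u01; have u0 i : 0 <= u i <= 1 by have /andP[/ltW -> ->] := u01 i.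
have : (0 <= \sum_i geninv psi (u i))%E.
  by apply: sume_ge0 => i _; exact: geninv_ge0.
have : (\sum_i geninv psi (u i))%E \is a fin_num.
  by apply/sum_fin_numP => i _ _; apply: geninv_fin_num; have /andP[] := u01 i.
rewrite /archimedean; case: (\sum_i _)%E => // x _; rewrite lee_fin.
exact: cm_generator_gt0.
Qed.

Lemma archimedean1 : archimedean psi (fun _ : I => 1) = 1.
Proof.
rewrite /archimedean (eq_bigr (fun=> 0%E)) => [|i _]; last exact: geninv1.
by rewrite big1//= (cmg_at0 psiP).
Qed.

End archimedean_copulas.

(** Each a k is counted for every j other than k, that is n - 1 times.  The
    terms g j may be infinite, so that the a k have to be real to cancel. *)
Lemma sum_leave_one_out (R : realType) n (g : 'I_n -> \bar R) (a : 'I_n -> R) :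
  (\sum_j (g j + \sum_(k | k != j) (a k)%:E) -
     (n%:R - 1)%:E * \sum_j (a j)%:E = \sum_j g j)%E.
Proof.
rewrite big_split /= sumEFin -EFinM.
have -> : (\sum_j \sum_(k | k != j) (a k)%:E)%E =
          ((n%:R - 1) * \sum_j a j)%:E.
  under eq_bigr do rewrite sumEFin.
  rewrite sumEFin; congr _%:E.
  under eq_bigr => j _.
    have -> : \sum_(k | k != j) a k = \sum_k a k - a j.
      by rewrite [in RHS](bigD1 j)//= addrAC subrr add0r.
    over.
  by rewrite sumrB sumr_const card_ord mulrBl mul1r mulr_natl.
by rewrite addeK.
Qed.

Section nested.
Context (R : realType) (S : nat) (d : 'I_S -> nat)
    (psi0 : R -> R) (psi : 'I_S -> R -> R) (C : (sindex d -> R) -> R)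
    (t : sindex d -> R)
    (psi0P : cm_generator psi0) (psiP : forall s, cm_generator (psi s))
    (CE : forall u, in_cube u ->
       C u = archimedean psi0 (fun s => archimedean (psi s) (sector u s)))
    (t01 : forall i, 0 < t i <= 1).

Let t_cube : in_cube t.
Proof. by move=> i; have /andP[/ltW -> ->] := t01 i. Qed.

Lemma geninv_nested u : in_cube u -> geninv psi0 (C u) =
  (\sum_s geninv psi0 (archimedean (psi s) (sector u s)))%E.
Proof.
move=> u01; rewrite CE// geninv_archimedean// => s.
by apply: archimedean_itv01 => // j; exact: u01.
Qed.

Lemma in_cube_replace_sector s (x : 'I_(d s) -> R) :
  in_cube x -> in_cube (replace_sector t s x).
Proof.
move=> x01 [s' j]; rewrite /replace_sector /=.
have [ss'|ss'] := eqVneq s s'; last by rewrite dfwithout//; exact: t_cube.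
by subst s'; rewrite dfwithin.
Qed.

Let others s : \bar R :=
  (\sum_(s' | s' != s) geninv psi0 (archimedean (psi s') (sector t s')))%E.

Let sector_fin_num s :
  geninv psi0 (archimedean (psi s) (sector t s)) \is a fin_num.
Proof. by apply/geninv_fin_num/archimedean_gt0 => // j; exact: t01. Qed.

Let others_fin_num s : others s \is a fin_num.
Proof. by apply/sum_fin_numP => s' _ _; exact: sector_fin_num. Qed.

Lemma geninv_replace_sector s (x : 'I_(d s) -> R) : in_cube x ->
  geninv psi0 (C (replace_sector t s x)) =
  (geninv psi0 (archimedean (psi s) x) + others s)%E.
Proof.
move=> x01; rewrite geninv_nested; last exact: in_cube_replace_sector.
rewrite (bigD1 s)//=; congr (geninv _ (archimedean _ _) + _)%E.
  by apply/funext => j; rewrite /sector /replace_sector /= dfwithin.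
apply: eq_bigr => s' ss'; congr (geninv _ (archimedean _ _)).
apply/funext => j.
by rewrite /sector /replace_sector /= dfwithout// eq_sym.
Qed.

Lemma geninv_replace_sector1 s :
  geninv psi0 (C (replace_sector t s (fun=> 1))) = others s.
Proof.
rewrite geninv_replace_sector; last by move=> j; rewrite ler01 lexx.
by rewrite archimedean1// geninv1// add0e.
Qed.

Lemma geninv_others s : others s =
  (geninv psi0 (C t) - geninv psi0 (archimedean (psi s) (sector t s)))%E.
Proof. by rewrite geninv_nested// (bigD1 s)//= addeAC subee// add0e. Qed.

Lemma replace_entry (y : sindex d -> R) s (j : 'I_(d s)) :
  (fun k => if k == Tagged (fun s => 'I_(d s)) j then y (existT _ s j) else t k) =
  replace_sector t s (fun k => if k == j then y (existT _ s j) else t (existT _ s k)).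
Proof.
apply/funext => -[s' k]; rewrite /replace_sector /=.
have [ss'|ss'] := eqVneq s' s.
  by subst s'; rewrite dfwithin eq_Tagged.
rewrite dfwithout 1?eq_sym//; case: eqP => // /(congr1 tag) /= e.
by rewrite e eqxx in ss'.
Qed.

(** The j-th term of the sum is geninv (psi s) of the value of C_s at t_s with
    its j-th entry replaced by y_sj, that is geninv (psi s) (y_sj) plus the
    geninv (psi s) (t_sk) for k != j; sum_leave_one_out then applies. *)
Lemma nested_sector_inversion (y : sindex d -> R) s :
  (forall i, 0 <= y i <= t i) ->
  ((\sum_(j < d s) geninv (psi s) (gen psi0
      (geninv psi0 (C (fun k => if k == existT _ s j then y (existT _ s j) else t k))
       - geninv psi0 (C (replace_sector t s (fun=> 1%R))))))
    - ((d s)%:R - 1)%R%:E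
      * geninv (psi s) (archimedean (psi s) (sector t s)))%E =
  (\sum_(j < d s) geninv (psi s) (y (existT _ s j)))%E.
Proof.
move=> yt; have t_fin i : geninv (psi s) (t i) \is a fin_num.
  by apply: geninv_fin_num; have /andP[] := t01 i.
have ts01 : in_cube (sector t s) by move=> j; exact: t_cube.
rewrite -[RHS](sum_leave_one_out _ (fun j => fine (geninv (psi s) (sector t s j)))).
congr (_ - _ * _)%E; last first.
  rewrite geninv_archimedean//; apply: eq_bigr => j _.
  exact/esym/fineK/t_fin.
apply: eq_bigr => j _.
rewrite replace_entry; set x := fun k => _.
have x01 : in_cube x.
  move=> k; rewrite /x; case: ifP => _; last exact: ts01.
  have /andP[y0 y1] := yt (existT _ s j); rewrite y0 (le_trans y1)//.
  by have /andP[] := t01 (existT _ s j).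
rewrite geninv_replace_sector1 geninv_replace_sector// addeK//.
rewrite geninvK//; last exact: archimedean_itv01.
rewrite geninv_archimedean// (bigD1 j)//= {1}/x eqxx; congr (_ + _)%E.
apply: eq_bigr => k /negbTE kj; rewrite /x kj; exact/esym/fineK/t_fin.
Qed.

End nested.

Theorem theorem4p1 (R : realType) (S : nat) (d : 'I_S -> nat)
    (psi0 : R -> R) (psi : 'I_S -> R -> R) (C : (sindex d -> R) -> R)
    (dT : measure_display) (T : measurableType dT) (P : probability T R)
    (U : sindex d -> {RV P >-> R}) (t : sindex d -> R)
    (S_gt0 : (0 < S)%N) (d_gt0 : forall s, (0 < d s)%N)
    (psi0P : cm_generator psi0) (psiP : forall s, cm_generator (psi s))
    (nestP : forall s, nesting_condition psi0 (psi s))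
    (CE : forall u, in_cube u ->
       C u = archimedean psi0 (fun s => archimedean (psi s) (sector u s)))
    (UC : follows U C)
    (t01 : forall i, 0 < t i <= 1) (Ct_gt0 : 0 < C t) :
  is_truncated_copula U t
    (fun u =>
       gen psi0 (\sum_(s < S) geninv psi0 (gen (psi s)
         ((\sum_(j < d s) geninv (psi s) (gen psi0
              (geninv psi0 (C t * sector u s j)%R
               - geninv psi0 (C (replace_sector t s (fun=> 1%R))))))
          - ((d s)%:R - 1)%R%:E
            * geninv (psi s) (archimedean (psi s) (sector t s)))))%E
       / C t) /\
  (forall s,
     geninv psi0 (C (replace_sector t s (fun=> 1))) =
     (geninv psi0 (C t)
      - geninv psi0 (archimedean (psi s) (sector t s)))%E).
Proof.
split; last first.
  by move=> s; rewrite (geninv_replace_sector1 psi0P psiP CE)// (geninv_others psi0P psiP CE).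
apply: (truncated_copulaP UC) => // y yt.
rewrite [in RHS]CE; last first.
  move=> i; have /andP[y0 /le_trans y1] := yt i.
  by rewrite y0 y1//; have /andP[] := t01 i.
congr (gen _ _ / _); apply: eq_bigr => s _; congr (geninv _ (gen _ _)).
rewrite -[RHS](nested_sector_inversion psi0P psiP CE t01)//.
congr (_ - _)%E; apply: eq_bigr => j _.
by rewrite /sector [C t * _]mulrC divfK// gt_eqF.
Qed.
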